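(* Fix a MEDIAN query $q$ (median of an attribute $A$ over the tuples satisfying a predicate $\varphi$), a synthetic database $D_s$, a distance bound $\tau>0$ and a privacy budget $\epsilon>0$. The randomized algorithm $Hist_{med}$ described in the context, viewed as a randomized map $D\mapsto o\in\{0,1\}$ of the private database $D$, satisfies $\epsilon$-differential privacy.
   Context: A database is a finite multiset of tuples over a single relation schema with fixed attributes. Two databases are neighbors, $D\approx D'$, if one is obtained from the other by adding or removing a single tuple. A randomized mechanism $\mathcal M$ is $\epsilon$-DP if $\Pr[\mathcal M(D)\in S]\le e^{\epsilon}\Pr[\mathcal M(D')\in S]$ for all $D\approx D'$ and all $S\subseteq \mathrm{Range}(\mathcal M)$. $Lap(b)$ is the Laplace distribution with mean $0$ and scale $b$. The predicate $\varphi$ is a Boolean condition on a single tuple; $A$ is an integer-valued attribute. The synthetic database $D_s$ is a fixed public input, and $q(D_s)$ is the value of the median query on it (a fixed number). Algorithm $Hist_{med}(q,D,D_s,\tau,\epsilon)$. Let $n'$ be the number of tuples of $D$ satisfying $\varphi$. Draw $\nu_q\sim Lap\left(\frac{1}{\epsilon/2}\right)$ and set $\tilde n=n'+\nu_q$. Let $q_1(D)$ be the number of tuples of $D$ satisfying $\varphi$ with $A\le q(D_s)-\tau$, and $q_2(D)$ the number of tuples of $D$ satisfying $\varphi$ with $A\ge q(D_s)+\tau$. Draw $\nu_{q_1},\nu_{q_2}\sim Lap\left(\frac{1}{\epsilon/2}\right)$. All three noise variables are independent. If $q_1(D)+\nu_{q_1}\ge\lceil\tilde n/2\rceil$, output $o=0$;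 else if $q_2(D)+\nu_{q_2}\ge\lceil\tilde n/2\rceil$, output $o=0$; else output $o=1$. *)

(* Defs.v *)
From HB Require Import structures.
From mathcomp Require Import all_boot all_order all_algebra.
From mathcomp Require Import finmap multiset.
From mathcomp Require Import all_classical all_reals all_analysis.
From mathcomp Require Import measurable_realfun exponential_distribution.

Set Implicit Arguments.
Unset Strict Implicit.
Unset Printing Implicit Defensive.

Import Order.TTheory GRing.Theory Num.Theory.
Import numFieldTopology.Exports.

Local Open Scope classical_set_scope.
Local Open Scope ring_scope.

(* The relation schema is abstracted by the choiceType T of its tuples: a
   predicate on a tuple is a [pred T], an integer-valued attribute is its
   projection [T -> int]. *)
Definition database (T : choiceType) : Type := {mset T}%mset.
Identity Coercion mset_of_database : database >-> multiset_of.

Definition neighbors (T : choiceType) (D D' : database T) : Prop :=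
  exists t : T, D' = (t +` D)%mset \/ D = (t +` D')%mset.

Definition differentially_private (R : realType) (T : choiceType)
    (d : measure_display) (Y : measurableType d) (eps : R)
    (M : database T -> probability Y R) : Prop :=
  forall D D' : database T, neighbors D D' ->
  forall S : set Y, measurable S ->
  (M D S <= (expR eps)%:E * M D' S)%E.

(* [count P D] counts tuples with multiplicity, through the coercion of
   multisets to sequences. *)
Definition is_median (R : realType) (T : choiceType) (phi : pred T)
    (A : T -> int) (D : database T) (m : R) : Prop :=
  let n := count phi D in
  let below := count (fun t => phi t && ((A t)%:~R <= m)) D in
  let above := count (fun t => phi t && (m <= (A t)%:~R)) D in
  (n <= 2 * below)%N /\ (n <= 2 * above)%N.

(* When the two middle values differ, or when no tuple satisfies phi, several
   values are medians; a median query returns any one of them. *)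
Definition median_query (R : realType) (T : choiceType) (phi : pred T)
    (A : T -> int) (q : database T -> R) : Prop :=
  forall D : database T, is_median phi A D (q D).

Section laplace_pdf.
Context {R : realType}.
Local Notation mu := (@lebesgue_measure R).

Definition laplace_pdf (b x : R) : R := expR (- (`|x| / b)) / (2 * b).

Lemma laplace_pdf_ge0 (b x : R) : 0 <= b -> 0 <= laplace_pdf b x.
Proof. by move=> b0; rewrite divr_ge0 ?expR_ge0// mulr_ge0. Qed.

Lemma continuous_laplace_pdf (b : R) : continuous (laplace_pdf b).
Proof.
move=> x; rewrite /laplace_pdf; apply: cvgM; last exact: cvg_cst.
apply: (@cvg_comp _ _ _ (fun x => - (`|x| / b)) expR);
  last exact: continuous_expR.
apply: cvgN; apply: cvgM; last exact: cvg_cst.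
exact: (@norm_continuous _ R^o).
Qed.

Lemma measurable_laplace_pdf (b : R) :
  measurable_fun [set: R] (laplace_pdf b).
Proof. by apply: continuous_measurable_fun; exact: continuous_laplace_pdf. Qed.

Lemma integral_laplace_pdf (b : R) : 0 < b ->
  (\int[mu]_x (laplace_pdf b x)%:E = 1)%E.
Proof.
move=> b0; have bV0 : 0 < b^-1 by rewrite invr_gt0.
rewrite ge0_symfun_integralT; last 3 first.
- by move=> x; exact/laplace_pdf_ge0/ltW.
- exact: continuous_laplace_pdf.
- by move=> x /=; rewrite /laplace_pdf normrN.
rewrite -set_itvcy -[in RHS](integral_exponential_pdf bV0).
have -> : (\int[mu]_x (exponential_pdf b^-1 x)%:E =
           \int[mu]_(x in `[0%R, +oo[) (exponential_pdf b^-1 x)%:E)%E.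
  rewrite [RHS]integral_mkcond; apply: eq_integral => x _.
  by rewrite /exponential_pdf !patchE; case: ifPn.
rewrite -ge0_integralZl//=.
- apply: eq_integral => x; rewrite inE/= in_itv/= andbT => x0.
  rewrite exponential_pdfE// -EFinM /laplace_pdf ger0_norm//.
  congr EFin; rewrite (_ : - (x / b) = - b^-1 * x); last by rewrite mulNr mulrC.
  by rewrite [2 * b]mulrC invfM [expR _ * _]mulrA [LHS]mulrC divfK// mulrC.
- apply/measurable_EFinP/measurable_funTS; exact: measurable_laplace_pdf.
- by move=> x _; rewrite lee_fin laplace_pdf_ge0// ltW.
Qed.

End laplace_pdf.

Definition laplace_prob {R : realType} (b : {posnum R}) : set R -> \bar R :=
  fun V => (\int[lebesgue_measure]_(x in V) (laplace_pdf b%:num x)%:E)%E.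

Section laplace_prob.
Context {R : realType}.
Variable b : {posnum R}.
Local Notation laplace := (laplace_prob b).

Let laplace0 : laplace set0 = 0%E.
Proof. by rewrite /laplace_prob integral_set0. Qed.

Let laplace_ge0 V : (0 <= laplace V)%E.
Proof. by apply: integral_ge0 => x _; rewrite lee_fin laplace_pdf_ge0. Qed.

Let laplace_sigma_additive : semi_sigma_additive laplace.
Proof.
move=> /= F mF tF mUF; rewrite /laplace_prob; apply: cvg_toP.
  apply: ereal_nondecreasing_is_cvgn => m n mn.
  apply: lee_sum_nneg_natr => // k _ _; apply: integral_ge0 => /= x Fkx.
  by rewrite lee_fin laplace_pdf_ge0.
rewrite ge0_integral_bigcup//=.
- apply/measurable_funTS/measurableT_comp => //.
  exact: measurable_laplace_pdf.
- by move=> x _; rewrite lee_fin laplace_pdf_ge0.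
Qed.

HB.instance Definition _ := isMeasure.Build _ _ _
  laplace laplace0 laplace_ge0 laplace_sigma_additive.

Let laplace_setT : laplace [set: R] = 1%E.
Proof. by rewrite /laplace_prob integral_laplace_pdf. Qed.

HB.instance Definition _ :=
  @Measure_isProbability.Build _ _ R laplace laplace_setT.

End laplace_prob.

Section product_prob.
Context d1 d2 (T1 : measurableType d1) (T2 : measurableType d2) (R : realType).
Variables (P1 : probability T1 R) (P2 : probability T2 R).

Definition product_prob : set (T1 * T2) -> \bar R := (P1 \x P2)%E.

HB.instance Definition _ := Measure.on product_prob.

Let product_prob_setT : product_prob [set: T1 * T2] = 1%E.
Proof.
rewrite /product_prob -setXTT product_measure1E//.
rewrite -[RHS]mule1.
exact: (congr2 _ (probability_setT P1) (probability_setT P2)).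
Qed.

HB.instance Definition _ :=
  @Measure_isProbability.Build _ _ R product_prob product_prob_setT.

End product_prob.

Section hist_med.
Context {R : realType} {T : choiceType}.
Variables (phi : pred T) (A : T -> int) (q : database T -> R).
Variables (Ds : database T) (tau eps : {posnum R}).

(* Joint law of the independent noises, grouped as ((nu_q, nu_q1), nu_q2). *)
Definition hist_med_noise : probability (R * R * R)%type R :=
  let lap : probability R R := laplace_prob (1 / (eps%:num / 2))%:pos in
  product_prob (product_prob lap lap) lap.

(* The output bit o, with [false] standing for 0 and [true] for 1. *)
Definition hist_med_out (D : database T) (nu : R * R * R) : bool :=
  let: (nu_q, nu_q1, nu_q2) := nu in
  let n' := count phi D in
  let n_tilde : R := n'%:R + nu_q in
  let q1 := count (fun t => phi t && ((A t)%:~R <= q Ds - tau%:num)) D in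
  let q2 := count (fun t => phi t && (q Ds + tau%:num <= (A t)%:~R)) D in
  if (Num.ceil (n_tilde / 2))%:~R <= q1%:R + nu_q1 then false
  else if (Num.ceil (n_tilde / 2))%:~R <= q2%:R + nu_q2 then false
  else true.

Lemma measurable_hist_med_out (D : database T) :
  measurable_fun [set: R * R * R] (hist_med_out D).
Proof.
have mc : measurable_fun [set: R] (fun x : R => (Num.ceil x)%:~R : R).
  apply: nondecreasing_measurable => // x y xy.
  by rewrite ler_int; exact: le_ceil.
have mn : measurable_fun [set: R * R * R]
    (fun nu => (Num.ceil (((count phi D)%:R + nu.1.1) / 2))%:~R : R).
  apply: (measurableT_comp mc).
  apply: measurable_funM => //; apply: measurable_funD => //.
  exact: measurableT_comp measurable_fst measurable_fst.
set a1 := count (fun t => phi t && ((A t)%:~R <= q Ds - tau%:num)) D.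
set a2 := count (fun t => phi t && (q Ds + tau%:num <= (A t)%:~R)) D.
rewrite (_ : hist_med_out D = fun nu =>
  if (Num.ceil (((count phi D)%:R + nu.1.1) / 2))%:~R <= a1%:R + nu.1.2
  then false
  else if (Num.ceil (((count phi D)%:R + nu.1.1) / 2))%:~R <= a2%:R + nu.2
  then false else true); last by apply/funext => -[[? ?] ?].
apply: measurable_fun_ifT => //.
  apply: measurable_fun_ler => //; apply: measurable_funD => //.
  exact: measurableT_comp measurable_snd measurable_fst.
apply: measurable_fun_ifT => //.
by apply: measurable_fun_ler => //; exact: measurable_funD.
Qed.

HB.instance Definition _ (D : database T) :=
  isMeasurableFun.Build _ _ _ _ (hist_med_out D) (measurable_hist_med_out D).

Definition hist_med (D : database T) : probability bool R :=
  distribution hist_med_noise (hist_med_out D).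

End hist_med.

(* Main.v *)
(** The output of the mechanism is a fixed function of the three noisy counts.
    Since [tau > 0], a tuple cannot be counted by both q1 and q2, so adding or
    removing one changes n' by at most 1 and only one of q1, q2, by at most 1:
    the L1-sensitivity of (n', q1, q2) is 2.  Translating a Laplace variable
    of scale [2 / eps] by [c] multiplies probabilities by at most
    [exp (|c| eps / 2)], hence the total loss is at most [exp eps]. *)

Require Import Defs.
From HB Require Import structures.
From mathcomp Require Import all_boot all_order all_algebra.
From mathcomp Require Import finmap multiset.
From mathcomp Require Import all_classical all_reals all_analysis.
From mathcomp Require Import measurable_realfun ring lra.

Set Implicit Arguments.
Unset Strict Implicit.
Unset Printing Implicit Defensive.

Import Order.TTheory GRing.Theory Num.Theory.
Import numFieldNormedType.Exports.

Local Open Scope classical_set_scope.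
Local Open Scope ring_scope.

Lemma measurable_shift (R : realType) (c : R) :
  measurable_fun [set: R] (shift c).
Proof. exact: measurable_funD. Qed.

(** Lebesgue measure is the only measure giving the half-open intervals []a, b]] their length, and
    translation preserves these lengths. *)
Lemma lebesgue_measure_shift (R : realType) (c : R) (V : set R) :
  measurable V ->
  lebesgue_measure (shift c @^-1` V) = lebesgue_measure V.
Proof.
move=> mV; apply/esym.
have := @lebesgue_measure_unique R
  (pushforward lebesgue_measure (shift c : _ -> measurableTypeR R)).
apply => //; first exact: measurable_shift.
move=> _ _ [[a b] _ <-] /=; rewrite /pushforward /=.
rewrite (_ : shift c @^-1` _ = `]a - c, b - c]%classic); last first.
  by apply/seteqP; split => x /=; rewrite !in_itv/= ltrBlDr lerBrDr.
rewrite !lebesgue_measure_itv/= !lte_fin ltrD2r.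
by case: ifPn => // _; rewrite -!EFinB; congr EFin; ring.
Qed.

(** The triangle inequality for [x + c], taken in the exponent. *)
Lemma laplace_pdf_shift_le (R : realType) (b c x : R) : 0 < b ->
  laplace_pdf b x <= expR (`|c| / b) * laplace_pdf b (x + c).
Proof.
move=> b0; rewrite /laplace_pdf mulrA -expRD ler_pM2r ?invr_gt0 ?mulr_gt0//.
rewrite ler_expR -mulrBl -mulNr ler_pM2r ?invr_gt0//.
by have := ler_normD x c; lra.
Qed.

Lemma laplace_prob_shift_le (R : realType) (b : {posnum R}) (c : R)
    (V : set R) : measurable V ->
  (laplace_prob b (shift c @^-1` V) <=
   (expR (`|c| / b%:num))%:E * laplace_prob b V)%E.
Proof.
move=> mV; have msV : measurable (shift c @^-1` V).
  by rewrite -[X in measurable X]setTI; exact: measurable_shift.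
have mpdf : measurable_fun [set: R] (EFin \o laplace_pdf b%:num).
  by apply/measurable_EFinP; exact: measurable_laplace_pdf.
have mspdf : measurable_fun [set: R] (EFin \o laplace_pdf b%:num \o shift c).
  exact: measurableT_comp mpdf (measurable_shift c).
have pdf0 x : (0 <= (laplace_pdf b%:num x)%:E)%E.
  by rewrite lee_fin laplace_pdf_ge0.
(* Change of variables by translation: both sides become integrals over the same set, where the
   densities compare pointwise. *)
have -> : laplace_prob b V =
    (\int[lebesgue_measure]_(x in shift c @^-1` V)
      (laplace_pdf b%:num (x + c))%:E)%E.
  rewrite -(@ge0_integral_pushforward _ _ (measurableTypeR R)
    (measurableTypeR R) R (shift c) (measurable_shift c) lebesgue_measure V
    (EFin \o laplace_pdf b%:num) mV
    (measurable_funTS mpdf) (fun x _ => pdf0 x)).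
  apply: eq_measure_integral => [|mf W mW _]; first exact: measurable_shift.
  exact/esym/lebesgue_measure_shift.
rewrite -ge0_integralZl//=; last exact: measurable_funTS.
apply: ge0_le_integral => //=.
- exact: measurable_funTS.
- by apply: measurable_funeM; exact: measurable_funTS mspdf.
- by move=> x _; rewrite -EFinM lee_fin laplace_pdf_shift_le.
Qed.

Lemma measurable_map_pair d1 d2 d1' d2'
    (T1 : measurableType d1) (T2 : measurableType d2)
    (T1' : measurableType d1') (T2' : measurableType d2')
    (f1 : T1 -> T1') (f2 : T2 -> T2') :
  measurable_fun setT f1 -> measurable_fun setT f2 ->
  measurable_fun setT (fun x => (f1 x.1, f2 x.2)).
Proof.
move=> mf1 mf2; apply: measurable_fun_pair.
  exact: measurableT_comp mf1 measurable_fst.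
exact: measurableT_comp mf2 measurable_snd.
Qed.

(** By integration over sections: [k2] bounds each section, then [k1] bounds the outer integral.
    General spaces and maps allow reuse on a nested product. *)
Lemma product_prob_map_le (R : realType) d1 d2 d1' d2'
    (T1 : measurableType d1) (T2 : measurableType d2)
    (T1' : measurableType d1') (T2' : measurableType d2')
    (P1 : probability T1 R) (P2 : probability T2 R)
    (Q1 : probability T1' R) (Q2 : probability T2' R)
    (f1 : T1 -> T1') (f2 : T2 -> T2') (k1 k2 : R) :
  measurable_fun setT f1 -> measurable_fun setT f2 -> 0 <= k1 -> 0 <= k2 ->
  (forall B, measurable B -> (P1 (f1 @^-1` B) <= k1%:E * Q1 B)%E) ->
  (forall B, measurable B -> (P2 (f2 @^-1` B) <= k2%:E * Q2 B)%E) ->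
  forall B, measurable B ->
  (product_prob P1 P2 ((fun x => (f1 x.1, f2 x.2)) @^-1` B) <=
   (k1 * k2)%:E * product_prob Q1 Q2 B)%E.
Proof.
move=> mf1 mf2 k10 k20 le1 le2 B mB; rewrite /product_prob /product_measure1.
have mQ2 : measurable_fun setT (Q2 \o xsection B).
  exact: measurable_fun_xsection.
have mQ2f : measurable_fun setT (Q2 \o xsection B \o f1).
  exact: measurableT_comp mQ2 mf1.
pose c1 := NngNum k10.
apply: (@le_trans _ _ (\int[P1]_x (k2%:E * (Q2 \o xsection B \o f1) x))%E).
  apply: ge0_le_integral => //=.
  - apply: measurable_fun_xsection.
    rewrite -[X in measurable X]setTI.
    exact: (measurable_map_pair mf1 mf2 measurableT mB).
  - exact: measurable_funeM.
  (* The section at [x] of the preimage is the [f2]-preimage of the section of [B] at [f1 x]. *)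
  - move=> x _; apply: le_trans (le2 _ (measurable_xsection _ mB)).
    by rewrite le_eqVlt; apply/orP; left; apply/eqP; congr (P2 _); apply/seteqP;
      split => y; rewrite /xsection/= !inE.
(* Once [k2] cancels, [x |-> Q2 (xsection B x)] is integrated against the pushforward of [P1] by
   [f1] and against the measure [k1 * Q1], which dominates it. *)
rewrite ge0_integralZl//= mulrC EFinM -muleA lee_wpmul2l//.
rewrite -(ge0_integral_mscale Q1 measurableT c1)//.
have := ge0_integral_pushforward mf1 P1 measurableT mQ2.
rewrite preimage_setT => <- //.
apply: ge0_le_measure_integral => //; exact: le1.
Qed.

Lemma hist_med_noise_shift_le (R : realType) (eps : {posnum R}) (c1 c2 c3 : R)
    (B : set (R * R * R)) : measurable B ->
  `|c1| + `|c2| + `|c3| <= 2 ->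
  (hist_med_noise eps
     ((fun nu => (nu.1.1 + c1, nu.1.2 + c2, nu.2 + c3)%R) @^-1` B) <=
   (expR eps%:num)%:E * hist_med_noise eps B)%E.
Proof.
move=> mB c_le2; set b : {posnum R} := (1 / (eps%:num / 2))%:pos.
have k0 (e : R) : 0 <= expR (`|e| / b%:num) by exact: expR_ge0.
have lap_le (e : R) := @laplace_prob_shift_le R b e.
have inner := product_prob_map_le (measurable_shift c1) (measurable_shift c2)
  (k0 _) (k0 _) (lap_le c1) (lap_le c2).
have := product_prob_map_le
  (measurable_map_pair (measurable_shift c1) (measurable_shift c2))
  (measurable_shift c3) (mulr_ge0 (k0 _) (k0 _)) (k0 _) inner (lap_le c3) mB.
move=> /le_trans; apply; apply: lee_wpmul2r => //.
(* The three factors combine into the exponent [(|c1| + |c2| + |c3|) / b], and [2 / b = eps]. *)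
rewrite lee_fin -!expRD ler_expR -!mulrDl.
by rewrite /b/= div1r invrK mulrCA ler_piMr// ler_pdivrMr ?mul1r.
Qed.

Lemma count_mset1D (T : choiceType) (p : pred T) (t : T) (D : database T) :
  count p (t +` D)%mset = (p t + count p D)%N.
Proof.
have /permP/(_ p) := perm_eq_seq_mset (t :: D).
by rewrite mset_cons seq_mset_id.
Qed.

(** Shifting each noise by the difference of the corresponding counts gives the same noisy counts on
    [D'] as on [D]. *)
Lemma hist_med_out_shift (R : realType) (T : choiceType) (phi : pred T)
    (A : T -> int) (q : database T -> R) (Ds : database T) (tau : {posnum R})
    (D D' : database T) :
  neighbors D D' ->
  exists c1 c2 c3 : R, `|c1| + `|c2| + `|c3| <= 2 /\
    forall nu, hist_med_out phi A q Ds tau D nu =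
      hist_med_out phi A q Ds tau D' (nu.1.1 + c1, nu.1.2 + c2, nu.2 + c3).
Proof.
pose low t := phi t && ((A t)%:~R <= q Ds - tau%:num).
pose high t := phi t && (q Ds + tau%:num <= (A t)%:~R).
case=> t tDD'.
exists ((count phi D)%:R - (count phi D')%:R).
exists ((count low D)%:R - (count low D')%:R).
exists ((count high D)%:R - (count high D')%:R).
split=> [|[[x y] z]]; last first.
  rewrite /hist_med_out /=.
  by do ?congr (if _ <= _ then _ else _);
    rewrite -?/low -?/high; do ?congr (Num.ceil (_ / 2))%:~R; ring.
have dist (p : pred T) :
    `|(count p D)%:R - (count p D')%:R| = (p t)%:R :> R.
  case: tDD' => ->; rewrite count_mset1D natrD.
    by rewrite opprD addrCA subrr addr0 normrN normr_nat.
  by rewrite addrK normr_nat.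
(* The total shift is the number of predicates among [phi], [low], [high] that hold of [t]; all
   three would force [q Ds + tau <= q Ds - tau]. *)
rewrite !dist -!natrD ler_nat /low /high.
case: (phi t) => //=.
have [lo|_] := boolP (_ <= _ - _); have [hi|_] := boolP (_ + _ <= _) => //.
have : 0 < tau%:num by [].
by lra.
Qed.

Theorem proposition6p2 (R : realType) (T : choiceType) (phi : pred T)
    (A : T -> int) (q : database T -> R) (q_median : median_query phi A q)
    (Ds : database T) (tau eps : {posnum R}) :
  differentially_private eps%:num (hist_med phi A q Ds tau eps).
Proof.
move=> D D' /(hist_med_out_shift phi A q Ds tau) [c1 [c2 [c3 [c_le2 outE]]]].
move=> S mS; rewrite /hist_med /distribution /pushforward.
have mB : measurable (hist_med_out phi A q Ds tau D' @^-1` S).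
  by rewrite -[X in measurable X]setTI; exact: measurable_hist_med_out.
(* The event for [D] is exactly the shift preimage of the event for [D']. *)
apply: le_trans (hist_med_noise_shift_le eps mB c_le2).
rewrite le_eqVlt; apply/orP; left; apply/eqP; congr (hist_med_noise eps _).
by apply/seteqP; split=> nu /=; rewrite outE.
Qed.
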